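(* Let $p\in[1,\infty]$, let $(\epsilon_n)_{n\ge1}$ be a sequence in $[0,\infty)^2$ converging to $(0,0)$, and let $X,Y$ be compact pmm-spaces. Then \[ \lim_{n\to\infty}\mathsf{PGW}_{\epsilon_n,p}(X,Y)=\mathsf{GW}_p(X,Y)=\lim_{n\to\infty}\mathsf{sPGW}_{\epsilon_n,p}(X,Y). \]
   Context: A pmm-space is a triple $(X,d_X,\mu_X)$ where $(X,d_X)$ is a complete separable metric space and $\mu_X$ a Borel probability measure; compact means $(X,d_X)$ compact. For a measure $\pi$ on $X\times Y$, $\pi_X,\pi_Y$ are its marginals. For $p<\infty$, $\|d_X-d_Y\|_{L^p(\pi\otimes\pi)}=\left(\iint|d_X(x,x')-d_Y(y,y')|^p\,d\pi(x,y)\,d\pi(x',y')\right)^{1/p}$; for $p=\infty$ it is the $\pi\otimes\pi$-essential supremum of $|d_X(x,x')-d_Y(y,y')|$. $\mathsf{GW}_p(X,Y)=\inf\|d_X-d_Y\|_{L^p(\pi\otimes\pi)}$ over Borel probability measures $\pi$ on $X\times Y$ with $\pi_X=\mu_X,\pi_Y=\mu_Y$. For $\epsilon=(\epsilon_1,\epsilon_2)$: $\mathcal{C}_\epsilon(\mu_X,\mu_Y)$ is the set of Borel probability measures $\pi$ on $X\times Y$ with $\pi_X\le(1+\epsilon_1)\mu_X$ and $\pi_Y\le(1+\epsilon_2)\mu_Y$ setwise on Borel sets; $\mathcal{S}_\epsilon(\mu_X,\mu_Y)$ is the set of Borel probability measures $\pi$ on $X\times Y$ such that $\pi_X,\mu_X$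 are mutually absolutely continuous with $\|d\pi_X/d\mu_X\|_{L^\infty(\mu_X)},\|d\mu_X/d\pi_X\|_{L^\infty(\pi_X)}\le1+\epsilon_1$, and $\pi_Y,\mu_Y$ are mutually absolutely continuous with $\|d\pi_Y/d\mu_Y\|_{L^\infty(\mu_Y)},\|d\mu_Y/d\pi_Y\|_{L^\infty(\pi_Y)}\le1+\epsilon_2$. $\mathsf{PGW}_{\epsilon,p}(X,Y)$ (resp. $\mathsf{sPGW}_{\epsilon,p}(X,Y)$) is the infimum of $\|d_X-d_Y\|_{L^p(\pi\otimes\pi)}$ over $\pi\in\mathcal{C}_\epsilon(\mu_X,\mu_Y)$ (resp. $\pi\in\mathcal{S}_\epsilon(\mu_X,\mu_Y)$). *)

(* Defs.v *)
From HB Require Import structures.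
From mathcomp Require Import all_boot all_order all_algebra.
From mathcomp Require Import all_classical all_reals all_analysis.
From mathcomp Require Import measurable_realfun lebesgue_measure lebesgue_integral.
From mathcomp Require Import ess_sup_inf hoelder.
Set Implicit Arguments.
Unset Strict Implicit.
Unset Printing Implicit Defensive.
Import Order.TTheory GRing.Theory Num.Theory.
Import numFieldNormedType.Exports.
Local Open Scope classical_set_scope.
Local Open Scope ring_scope.

Section metric.
Context {R : realType} {T : Type}.
Variable dist : T -> T -> R.

Definition is_metric : Prop :=
  [/\ (forall x y, 0 <= dist x y),
      (forall x y, dist x y = 0 <-> x = y),
      (forall x y, dist x y = dist y x) &
      (forall x y z, dist x z <= dist x y + dist y z)].

Definition dball (x : T) (r : R) : set T := [set y | dist x y < r].

Definition dopen (A : set T) : Prop :=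
  forall x, A x -> exists2 r : R, 0 < r & dball x r `<=` A.

Definition dcompact : Prop :=
  forall (I : Type) (U : I -> set T), (forall i, dopen (U i)) ->
    [set: T] `<=` \bigcup_i U i ->
    exists2 F : set I, finite_set F & [set: T] `<=` \bigcup_(i in F) U i.

Definition dcomplete : Prop :=
  forall u : nat -> T,
    (forall e : R, 0 < e -> exists N, forall m n, (N <= m)%N -> (N <= n)%N ->
        dist (u m) (u n) < e) ->
    exists x, forall e : R, 0 < e -> exists N, forall n, (N <= n)%N ->
        dist (u n) x < e.

Definition dseparable : Prop :=
  exists D : nat -> T, forall x (e : R), 0 < e -> exists n, dist x (D n) < e.

End metric.

Definition compact_pmm {d} {T : measurableType d} {R : realType}
    (dist : T -> T -> R) (mu : probability T R) : Prop :=
  [/\ is_metric dist,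
      (@measurable d T = <<s [set A | dopen dist A] >>),
      dcomplete dist, dseparable dist & dcompact dist].

Section marginals.
Local Open Scope ereal_scope.
Context {d1 d2} {T1 : measurableType d1} {T2 : measurableType d2} {R : realType}.
Variable P : {measure set (T1 * T2)%type -> \bar R}.

Definition marg1 : set T1 -> \bar R := fun A => P (fst @^-1` A).
Definition marg2 : set T2 -> \bar R := fun B => P (snd @^-1` B).

Let marg1_0 : marg1 set0 = 0.
Proof. by rewrite /marg1 preimage_set0 measure0. Qed.
Let marg1_ge0 A : 0 <= marg1 A.
Proof. exact: measure_ge0. Qed.
Let marg1_sa : semi_sigma_additive marg1.
Proof.
move=> F mF tF mUF; rewrite /marg1 preimage_bigcup.
have mf := @measurable_fst _ _ T1 T2.
apply: measure_semi_sigma_additive.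
- by move=> n; rewrite -[X in measurable X]setTI; exact: mf.
- apply/trivIsetP => /= i j _ _ ij; rewrite -preimage_setI.
  by move/trivIsetP : tF => /(_ _ _ _ _ ij) ->//; rewrite preimage_set0.
- by rewrite -preimage_bigcup -[X in measurable X]setTI; exact: mf.
Qed.
HB.instance Definition _ := isMeasure.Build _ _ _ marg1 marg1_0 marg1_ge0 marg1_sa.

Let marg2_0 : marg2 set0 = 0.
Proof. by rewrite /marg2 preimage_set0 measure0. Qed.
Let marg2_ge0 A : 0 <= marg2 A.
Proof. exact: measure_ge0. Qed.
Let marg2_sa : semi_sigma_additive marg2.
Proof.
move=> F mF tF mUF; rewrite /marg2 preimage_bigcup.
have mf := @measurable_snd _ _ T1 T2.
apply: measure_semi_sigma_additive.
- by move=> n; rewrite -[X in measurable X]setTI; exact: mf.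
- apply/trivIsetP => /= i j _ _ ij; rewrite -preimage_setI.
  by move/trivIsetP : tF => /(_ _ _ _ _ ij) ->//; rewrite preimage_set0.
- by rewrite -preimage_bigcup -[X in measurable X]setTI; exact: mf.
Qed.
HB.instance Definition _ := isMeasure.Build _ _ _ marg2 marg2_0 marg2_ge0 marg2_sa.

End marginals.

(* Radon-Nikodym derivative bound: nu << mu, and some (hence every) density
   h = d nu / d mu satisfies || h ||_{L^oo(mu)} <= c. *)
Definition RN_Linf_le {d} {T : measurableType d} {R : realType}
    (nu mu : {measure set T -> \bar R}) (c : R) : Prop :=
  nu `<< mu /\
  exists h : T -> \bar R,
    [/\ measurable_fun [set: T] h, (forall x, (0 <= h x)%E),
        (forall A, measurable A -> nu A = (\int[mu]_(x in A) h x)%E) &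
        (Lnorm mu +oo h <= c%:E)%E].

Section GW.
Local Open Scope ereal_scope.
Context {d1 d2} {T1 : measurableType d1} {T2 : measurableType d2} {R : realType}.
Variables (dX : T1 -> T1 -> R) (dY : T2 -> T2 -> R).
Variables (muX : probability T1 R) (muY : probability T2 R).

Definition dist_gap (pi : probability (T1 * T2)%type R) (p : \bar R) : \bar R :=
  Lnorm (pi \x pi) p
    (fun z : ((T1 * T2) * (T1 * T2))%type => (dX z.1.1 z.2.1 - dY z.1.2 z.2.2)%R%:E).

Definition couplings : set (probability (T1 * T2)%type R) :=
  [set pi | (forall A, measurable A -> marg1 pi A = muX A) /\
            (forall B, measurable B -> marg2 pi B = muY B)].

Definition Ceps (e : R * R) : set (probability (T1 * T2)%type R) :=
  [set pi | (forall A, measurable A -> marg1 pi A <= (1 + e.1)%R%:E * muX A) /\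
            (forall B, measurable B -> marg2 pi B <= (1 + e.2)%R%:E * muY B)].

Definition Seps (e : R * R) : set (probability (T1 * T2)%type R) :=
  [set pi | [/\ RN_Linf_le (marg1 pi) muX (1 + e.1),
                RN_Linf_le muX (marg1 pi) (1 + e.1),
                RN_Linf_le (marg2 pi) muY (1 + e.2) &
                RN_Linf_le muY (marg2 pi) (1 + e.2)]].

Definition GW (p : \bar R) : \bar R :=
  ereal_inf [set dist_gap pi p | pi in couplings].

Definition PGW (e : R * R) (p : \bar R) : \bar R :=
  ereal_inf [set dist_gap pi p | pi in Ceps e].

Definition sPGW (e : R * R) (p : \bar R) : \bar R :=
  ereal_inf [set dist_gap pi p | pi in Seps e].

End GW.

(* Main.v *)
Require Import Defs.
From HB Require Import structures.
From mathcomp Require Import all_boot all_order all_algebra.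
From mathcomp Require Import all_classical all_reals all_analysis.
From mathcomp Require Import measurable_realfun lebesgue_measure lebesgue_integral.
From mathcomp Require Import ess_sup_inf hoelder.
From mathcomp Require Import ring lra.
Import Order.TTheory GRing.Theory Num.Theory.
Import numFieldNormedType.Exports.
Local Open Scope classical_set_scope.
Local Open Scope ring_scope.

(** Couplings are admissible for both relaxations and the strong relaxation
    refines the weak one, so [PGW <= sPGW <= GW]; it remains to bound [GW] by
    [PGW] up to a small error.

    For [p < oo], let [pi] have marginals bounded by [(1 + dl)] times [muX] and
    [muY], and put [a = 1 / (1 + dl)]. Completing [a pi] by [1 - a] times the
    product of the normalized defects of its marginals gives a coupling, and the
    distance gap being bounded by some [D], its [p]-th power cost exceeds that
    of [pi] by at most [2 (1 - a) D^p].

    For [p = oo] small masses may be expensive, so a limit is taken instead. Cut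
    [X] and [Y] into finitely many blocks of small diameter and let [M] be the
    limit, along an ultrafilter, of the masses that [pi_n] gives to the products
    of blocks. Then [M] couples the block masses of [muX] and [muY], and
    spreading [M i j] over the [(i, j)] block proportionally to [muX \x muY]
    gives a coupling. Two blocks charged by [M] are charged by some [pi_n], hence
    contain points of almost optimal gap, and the gap varies little on blocks. *)

(** * Constructing probability measures *)

Section probabilities.
Local Open Scope ereal_scope.
Context {d} {T : measurableType d} {R : realType}.

Section measure_setT1.
Variables (m : {measure set T -> \bar R}) (m1 : m setT = 1).

(** The proof of total mass one is an argument of this alias of [m], so that the probability
    structure can be attached to it. *)
Definition measure_setT1 of m setT = 1 : set T -> \bar R := m.

HB.instance Definition _ := Measure.copy (measure_setT1 m1) m.
HB.instance Definition _ :=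
  Measure_isProbability.Build _ _ _ (measure_setT1 m1) m1.

End measure_setT1.

Lemma probability_of_measure (m : {measure set T -> \bar R}) : m setT = 1 ->
  exists P : probability T R, forall A, P A = m A.
Proof. by move=> m1; exists (measure_setT1 m m1). Qed.

Lemma probability_of_fun (f : set T -> \bar R) :
  (forall A, measurable A -> 0 <= f A) -> f set0 = 0 -> f setT = 1 ->
  semi_sigma_additive f ->
  exists P : probability T R, forall A, measurable A -> P A = f A.
Proof.
move=> f0 fe f1 fs.
(* Measures are required to be nonnegative on nonmeasurable sets as well. *)
pose g A : \bar R := maxe 0 (f A).
have gE A : measurable A -> g A = f A by move=> mA; apply/max_idPr/f0.
have g0 : g set0 = 0 by rewrite gE.
have gge0 A : 0 <= g A by rewrite le_max lexx.
have gs : semi_sigma_additive g.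
  move=> F mF tF mU; rewrite gE//; have := fs F mF tF mU.
  by under [X in _ -> X @ _ --> _]eq_fun do under eq_bigr do rewrite gE//.
pose m : {measure set T -> \bar R} := HB.pack g (isMeasure.Build _ _ _ g g0 gge0 gs).
have [|P PE] := probability_of_measure m; first by rewrite [LHS]gE.
by exists P => A mA; rewrite PE [LHS]gE.
Qed.

(** Take [S = (P - a Q) / (1 - a)]: the domination makes it nonnegative, and [P - a Q] has total
    mass [1 - a > 0]. *)
Lemma probability_residual (P Q : probability T R) (a : R) : (0 <= a < 1)%R ->
  (forall A, measurable A -> a%:E * Q A <= P A) ->
  exists S : probability T R,
    forall A, measurable A -> P A = a%:E * Q A + (1 - a)%:E * S A.
Proof.
move=> /andP[a0 a1] aQP.
have b0 : (0 < 1 - a)%R by rewrite subr_gt0.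
have [||||S SE] := @probability_of_fun
    (fun A => (1 - a)^-1%:E * (P A - a%:E * Q A)).
- move=> A mA; rewrite mule_ge0 ?lee_fin ?invr_ge0 ?(ltW b0)//.
  by rewrite sube_ge0 ?aQP// fin_numM// fin_num_measure.
- by rewrite !measure0 mule0 sube0 mule0.
- by rewrite !probability_setT mule1 -EFinB -EFinM mulVf ?gt_eqF.
- move=> F mF tF mU.
  rewrite [X in X @ _ --> _](_ : _ = fun n => (1 - a)^-1%:E *
     (\sum_(0 <= i < n) P (F i) - a%:E * \sum_(0 <= i < n) Q (F i))); last first.
    apply/funext => n; rewrite ge0_sume_distrr//.
    under [in RHS]eq_bigr do rewrite -[P _]fineK ?fin_num_measure//.
    under [X in _ - X]eq_bigr do
      rewrite -[Q _]fineK ?fin_num_measure// -EFinM.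
    rewrite !sumEFin -EFinB -EFinM -sumrB mulr_sumr -sumEFin.
    apply: eq_bigr => i _.
    by rewrite -[in LHS](@fineK _ (P _)) ?fin_num_measure//
       -[in LHS](@fineK _ (Q _)) ?fin_num_measure// -EFinM -EFinB -EFinM.
  apply: cvgeZl => //; apply: cvgeB.
  + by rewrite fin_num_adde_defr// fin_num_measure.
  + exact: measure_semi_sigma_additive.
  + by apply: cvgeZl => //; exact: measure_semi_sigma_additive.
exists S => A mA; rewrite SE// muleA -EFinM mulfV ?gt_eqF// mul1e.
rewrite addeC subeK// fin_numM// fin_num_measure//.
Qed.

End probabilities.

(** * Relaxed couplings: inclusions and completion to a coupling *)

Section eps_couplings.
Local Open Scope ereal_scope.
Context {d1 d2} {T1 : measurableType d1} {T2 : measurableType d2} {R : realType}.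
Variables (muX : probability T1 R) (muY : probability T2 R).
Implicit Types (pi : probability (T1 * T2)%type R) (e : R * R).

Lemma marg1_setT pi : marg1 pi setT = 1.
Proof. by rewrite /marg1 preimage_setT; exact: probability_setT. Qed.

Lemma marg2_setT pi : marg2 pi setT = 1.
Proof. by rewrite /marg2 preimage_setT; exact: probability_setT. Qed.

Lemma marg1_product (P : probability T1 R) (Q : probability T2 R) A :
  measurable A -> marg1 (P \x Q) A = P A.
Proof.
move=> mA; rewrite /marg1 (_ : _ @^-1` _ = A `*` setT); last first.
  by apply/seteqP; split => [] [x y]//= [].
rewrite -[RHS]mule1 -(probability_setT Q).
exact: product_measure1E.
Qed.

Lemma marg2_product (P : probability T1 R) (Q : probability T2 R) B :
  measurable B -> marg2 (P \x Q) B = Q B.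
Proof.
move=> mB; rewrite /marg2 (_ : _ @^-1` _ = setT `*` B); last first.
  by apply/seteqP; split => [] [x y]//= [].
rewrite -[RHS]mul1e -(probability_setT P).
exact: product_measure1E.
Qed.

Lemma couplings_nonempty : couplings muX muY !=set0.
Proof.
exists (muX \x muY); split => A mA; [exact: marg1_product|exact: marg2_product].
Qed.

(** The constant [1] serves as density. This is what places couplings inside [Seps]. *)
Lemma RN_Linf_le_eq d (T : measurableType d) (nu : {measure set T -> \bar R})
    (mu : {measure set T -> \bar R}) (c : R) :
  mu setT = 1 -> (1 <= c)%R -> (forall A, measurable A -> nu A = mu A) ->
  RN_Linf_le nu mu c.
Proof.
move=> mu1 c1 numu; split.
  by apply/null_content_dominatesP => A mA muA; rewrite numu.
exists (cst 1); split => //.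
- by move=> A mA; rewrite integral_cst// mul1e numu.
- rewrite unlock mu1 lte01 ; apply/ess_supP/nearW => x /=.
  by rewrite normr1 lee_fin.
Qed.

(** Integrate over [A] the almost everywhere bound on the density. This is what places [Seps] inside
    [Ceps]. *)
Lemma RN_Linf_leW d (T : measurableType d) (nu : {measure set T -> \bar R})
    (mu : {measure set T -> \bar R}) (c : R) A : mu setT = 1 -> (0 <= c)%R ->
  RN_Linf_le nu mu c -> measurable A -> nu A <= c%:E * mu A.
Proof.
move=> mu1 c0 [_ [h [mh h0 nuE hc]]] mA; rewrite nuE//.
move: hc; rewrite unlock mu1 lte01 => /ess_supP hc.
rewrite -integral_cst//; apply: ae_ge0_le_integral => //.
  + exact: measurable_funTS.
  + by apply: filterS hc => x /= + _; rewrite gee0_abs.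
Qed.

Lemma couplings_Seps e : (0 <= e.1)%R -> (0 <= e.2)%R ->
  couplings muX muY `<=` Seps muX muY e.
Proof.
move=> e1 e2 pi [piX piY].
by split; apply: RN_Linf_le_eq; rewrite ?lerDl//; first
  [exact: probability_setT|exact: marg1_setT|exact: marg2_setT
  |exact: piX|exact: piY|by move=> A mA; exact/esym/piX
  |by move=> A mA; exact/esym/piY].
Qed.

Lemma Seps_Ceps e : (0 <= e.1)%R -> (0 <= e.2)%R ->
  Seps muX muY e `<=` Ceps muX muY e.
Proof.
move=> e1 e2 pi [piX _ piY _].
by split => A mA; apply: RN_Linf_leW => //; by [exact: probability_setT|rewrite addr_ge0].
Qed.

Lemma subset_Ceps e e' : (e.1 <= e'.1)%R -> (e.2 <= e'.2)%R ->
  Ceps muX muY e `<=` Ceps muX muY e'.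
Proof.
move=> e1 e2 pi [piX piY]; split => A mA.
- by rewrite (le_trans (piX _ mA))// lee_wpmul2r// lee_fin lerD2l.
- by rewrite (le_trans (piY _ mA))// lee_wpmul2r// lee_fin lerD2l.
Qed.

(* The missing mass [1 - a] of [a pi] is put on the product of the two
   normalized marginal defects. *)
Lemma Ceps_completion (dl : R) pi : (0 < dl)%R ->
  Ceps muX muY (dl, dl) pi ->
  let a := ((1 + dl)^-1)%R in
  exists sigma tau : probability (T1 * T2)%type R, couplings muX muY sigma /\
    (forall C, measurable C -> sigma C = a%:E * pi C + (1 - a)%:E * tau C).
Proof.
move=> dl0 [/= piX piY]; set c := (1 + dl)%R.
pose a := (c^-1)%R.
have c0 : (0 < c)%R by rewrite addr_gt0.
have a0 : (0 < a)%R by rewrite invr_gt0.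
have a1 : (a < 1)%R by rewrite invf_lt1// ltrDl.
have b0 : (0 <= 1 - a)%R by rewrite subr_ge0 ltW.
have [P1 P1E] := probability_of_measure (marg1 pi) (marg1_setT pi).
have [P2 P2E] := probability_of_measure (marg2 pi) (marg2_setT pi).
have scale d (T : measurableType d) (P Q : probability T R) :
    (forall A, measurable A -> Q A <= c%:E * P A) ->
    forall A, measurable A -> a%:E * Q A <= P A.
  by move=> QP A mA; rewrite lee_pdivrMl// QP.
have a01 : (0 <= a < 1)%R by rewrite ltW.
have le1 A : measurable A -> a%:E * P1 A <= muX A.
  by apply: scale => {}A mA; rewrite P1E piX.
have le2 B : measurable B -> a%:E * P2 B <= muY B.
  by apply: scale => {}B mB; rewrite P2E piY.
have [S1 S1E] := probability_residual muX P1 a a01 le1.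
have [S2 S2E] := probability_residual muY P2 a a01 le2.
pose tau : probability (T1 * T2)%type R := S1 \x S2.
pose m := measure_add (mscale (NngNum (ltW a0)) pi) (mscale (NngNum b0) tau).
have mE C : m C = a%:E * pi C + (1 - a)%:E * tau C.
  by rewrite /m measure_addE.
have [|sigma sigmaE] := probability_of_measure m.
  by rewrite [LHS]mE !probability_setT !mule1 -EFinD addrC subrK.
exists sigma, tau; split; last by move=> C mC; rewrite sigmaE [LHS]mE.
split => [A mA|B mB].
- rewrite S1E// P1E /marg1; etransitivity; first exact: sigmaE.
  rewrite [LHS]mE; congr (_ + _ * _).
  exact: marg1_product.
- rewrite S2E// P2E /marg2; etransitivity; first exact: sigmaE.
  rewrite [LHS]mE; congr (_ + _ * _).
  exact: marg2_product.
Qed.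

End eps_couplings.

(** * Integrals against a mixture of two probabilities *)

Section mixture.
Local Open Scope ereal_scope.
Context {d} {T : measurableType d} {R : realType}.
Variables (sigma pi tau : probability T R) (a : R).
Hypotheses (a01 : (0 <= a <= 1)%R) (sigmaE : forall C, measurable C ->
  sigma C = a%:E * pi C + (1 - a)%:E * tau C).

(** The [pi] term only shrinks under the factor [a <= 1], and the [tau] term is at most
    [(1 - a) * M] since [tau] has mass one. *)
Lemma integral_mixture_le (F : T -> \bar R) (M : R) :
  measurable_fun setT F -> (forall x, 0 <= F x <= M%:E) ->
  \int[sigma]_x F x <= \int[pi]_x F x + ((1 - a) * M)%:E.
Proof.
move=> mF FM; have /andP[a0 a1] := a01.
have b0 : (0 <= 1 - a)%R by rewrite subr_ge0.
have F0 x : 0 <= F x by have /andP[] := FM x.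
pose m := measure_add (mscale (NngNum a0) pi) (mscale (NngNum b0) tau).
rewrite (eq_measure_integral m); last first.
  move=> A mA _; have mE : m A = a%:E * pi A + (1 - a)%:E * tau A.
    exact: measure_addE.
  by rewrite [RHS]mE; exact: sigmaE.
rewrite ge0_integral_measure_add// !ge0_integral_mscale//=; apply: leeD.
  by rewrite gee_pMl// ?lee_fin//; exact: integral_ge0.
rewrite EFinM lee_wpmul2l ?lee_fin//.
rewrite -[leRHS]mule1 -(probability_setT tau) -integral_cst//.
by apply: ge0_le_integral => // x _; have /andP[] := FM x.
Qed.

(** By Tonelli, [sigma] is replaced by [pi] in the inner integral and then in the outer one. Each
    replacement costs [(1 - a) * M], whence the factor 2. *)
Lemma integral_mixture_prod_le (f : T * T -> \bar R) (M : R) :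
  measurable_fun setT f -> (forall z, 0 <= f z <= M%:E) ->
  \int[sigma \x sigma]_z f z <=
    \int[pi \x pi]_z f z + (2 * (1 - a) * M)%:E.
Proof.
move=> mf fM; have /andP[a0 a1] := a01.
have b0 : (0 <= 1 - a)%R by rewrite subr_ge0.
have f0 z : 0 <= f z by have /andP[] := fM z.
have M0 : 0 <= M%:E by have /andP[] := fM (point, point); exact: le_trans.
rewrite !fubini_tonelli1//.
have mF := measurable_fun_fubini_tonelli_F f mf f0 (m2 := pi).
have FM x : 0 <= fubini_F pi f x <= M%:E.
  rewrite integral_ge0//= -[leRHS]mule1 -(probability_setT pi) -integral_cst//.
  apply: ge0_le_integral => //; first exact: measurableT_comp.
  by move=> y _; have /andP[] := fM (x, y).
apply: (@le_trans _ _ (\int[sigma]_x (fubini_F pi f x + ((1 - a) * M)%:E))).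
  apply: ge0_le_integral => //.
  - by move=> x _; exact: integral_ge0.
  - exact: (measurable_fun_fubini_tonelli_F f mf f0 (m2 := sigma)).
  - exact: emeasurable_funD.
  - move=> x _; apply: integral_mixture_le => //; exact: measurableT_comp.
rewrite ge0_integralD//; last 2 first.
- by move=> x _; have /andP[] := FM x.
- by move=> x _; rewrite lee_fin mulr_ge0.
have -> : \int[sigma]_x ((1 - a) * M)%:E = ((1 - a) * M)%:E.
  by rewrite -[RHS]mule1 -(probability_setT sigma) -integral_cst.
rewrite -mulrA mulr_natl mulr2n EFinD addeA leeD2r//.
exact: integral_mixture_le.
Qed.

End mixture.

(** * The case of a finite exponent *)

Lemma powR_superadditive {R : realType} (p x y : R) : 1 <= p -> 0 <= x -> 0 <= y ->
  x `^ p + y `^ p <= (x + y) `^ p.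
Proof.
move=> p1 x0 y0; have p0 : 0 < p by rewrite (lt_le_trans _ p1).
(* Each power [z^p] is split as [z * z^(p-1)]; the second factor is monotone in [z] because
   [p >= 1]. *)
rewrite -(mulr_powRB1 x0 p0) -(mulr_powRB1 y0 p0).
rewrite -(mulr_powRB1 (addr_ge0 x0 y0) p0) mulrDl.
by rewrite lerD// ler_wpM2l// ge0_ler_powR ?subr_ge0// ?nnegrE ?addr_ge0// ?lerDl ?lerDr.
Qed.

Section finite_exponent.
Local Open Scope ereal_scope.
Context {d1 d2} {T1 : measurableType d1} {T2 : measurableType d2} {R : realType}.
Variables (dX : T1 -> T1 -> R) (dY : T2 -> T2 -> R).
Variables (muX : probability T1 R) (muY : probability T2 R).

Definition gap (z : (T1 * T2) * (T1 * T2)) : R :=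
  (dX z.1.1 z.2.1 - dY z.1.2 z.2.2)%R.

Variable D : R.
Hypotheses (mgap : measurable_fun setT gap)
  (gapD : forall z, (`|gap z| <= D)%R).

Lemma GW_le_Ceps_fin (p e : R) : (1 <= p)%R -> (0 < e)%R ->
  exists2 dl : R, (0 < dl)%R & forall pi, Ceps muX muY (dl, dl) pi ->
    GW dX dY muX muY p%:E <= dist_gap dX dY pi p%:E + e%:E.
Proof.
move=> p1 e0; have p0 : (0 < p)%R by rewrite (lt_le_trans _ p1).
pose K := (D `^ p)%R; have K0 : (0 <= K)%R by exact: powR_ge0.
(* Chosen so that [2 * dl * K <= e^p]; the [+ 1] keeps the denominator positive when [K = 0]. *)
pose dl := (e `^ p / (2 * K + 1))%R.
have K1 : (0 < 2 * K + 1)%R by rewrite ltr_wpDl// mulr_ge0.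
have dl0 : (0 < dl)%R by rewrite divr_gt0// powR_gt0.
exists dl => // pi pidl.
have [sigma [tau [csigma sigmaE]]] := Ceps_completion muX muY dl pi dl0 pidl.
set a := ((1 + dl)^-1)%R in sigmaE.
have c0 : (0 < 1 + dl)%R by rewrite addr_gt0.
have a01 : (0 <= a <= 1)%R.
  by rewrite invr_ge0 ltW//= invf_le1// lerDl ltW.
have adl : (1 - a <= dl)%R.
  have -> : (1 - a = a * dl)%R.
    apply/eqP; rewrite subr_eq -[eqbLHS](mulVf (lt0r_neq0 c0)) -/a.
    by rewrite mulrDr mulr1 addrC.
  by rewrite ler_piMl ?(ltW dl0)//; case/andP: a01.
apply: (@le_trans _ _ (dist_gap dX dY sigma p%:E)).
  by apply: ereal_inf_lbound; exists sigma.
set x := dist_gap dX dY pi p%:E; have x0 : 0 <= x by exact: Lnorm_ge0.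
pose f z := `|(gap z)%:E| `^ p.
have fM z : 0 <= f z <= K%:E.
  rewrite poweR_ge0//= (_ : f z = (`|gap z| `^ p)%:E)// lee_fin.
  by rewrite ge0_ler_powR ?nnegrE ?(ltW p0)// (le_trans _ (gapD z)).
have mf : measurable_fun setT f.
  apply: (@measurableT_comp _ _ _ _ _ _ (fun x => poweR x p)).
    exact: measurable_poweR.
  by apply: measurableT_comp => //; exact/measurable_EFinP.
have [xfin|] := boolP (x \is a fin_num); last first.
  by rewrite ge0_fin_numE// -leNgt leye_eq => /eqP ->; rewrite addye// leey.
have xp : x `^ p = \int[pi \x pi]_z f z by rewrite /x /dist_gap poweR_Lnorm ?gt_eqF.
have le1 : \int[sigma \x sigma]_z f z <= (x + e%:E) `^ p.
  apply: (le_trans (integral_mixture_prod_le _ _ _ _ a01 sigmaE _ _ mf fM)).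
  rewrite -xp -(fineK xfin) -(EFinD (fine x) e) !poweR_EFin -EFinD lee_fin.
  (* Since [x^p + e^p <= (x + e)^p], it suffices that the mixture error [2 * (1 - a) * K] be at most
     [e^p], and [1 - a <= dl]. *)
  apply: le_trans (powR_superadditive _ _ _ p1 (fine_ge0 x0) (ltW e0)).
  rewrite lerD2l (@le_trans _ _ (dl * (2 * K + 1))%R)//; last first.
    by rewrite /dl divfK// gt_eqF.
  rewrite -mulrA mulrCA ler_pM ?mulr_ge0 ?subr_ge0//; first by case/andP: a01.
  by rewrite lerDl.
have -> : dist_gap dX dY sigma p%:E = (\int[sigma \x sigma]_z f z) `^ p^-1.
  by rewrite /dist_gap unlock.
have xe0 : 0 <= x + e%:E by rewrite adde_ge0// lee_fin ltW.
apply: (@le_trans _ _ (((x + e%:E) `^ p) `^ p^-1)).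
  apply: gt0_ler_poweR => //; first by rewrite invr_ge0 ltW.
  - by rewrite in_itv/= leey integral_ge0// => z _; case/andP: (fM z).
  - by rewrite in_itv/= leey poweR_ge0.
by rewrite -poweRrM mulfV ?gt_eqF// poweRe1.
Qed.

End finite_exponent.

(** * Compact metric spaces: measurability, boundedness, fine partitions *)

Section metric_lemmas.
Context {d} {T : measurableType d} {R : realType}.
Variables (dist : T -> T -> R) (dm : is_metric dist).

Lemma metric_ge0 x y : 0 <= dist x y. Proof. by case: dm. Qed.
Lemma metricC x y : dist x y = dist y x. Proof. by case: dm. Qed.
Lemma metric_triangle y x z : dist x z <= dist x y + dist y z.
Proof. by case: dm. Qed.
Lemma metricxx x : dist x x = 0. Proof. by case: dm => _ /(_ x x)[_ ->]. Qed.

Lemma metric_quad x y x' y' : `|dist x y - dist x' y'| <= dist x x' + dist y y'.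
Proof.
have h1 := metric_triangle x' x y; have h2 := metric_triangle y' x' y.
have h3 := metric_triangle x x' y'; have h4 := metric_triangle y x y'.
rewrite [dist x' x]metricC in h3; rewrite [dist y' y]metricC in h2.
by rewrite ler_norml; apply/andP; split; lra.
Qed.

Lemma dopen_dball x r : dopen dist (dball dist x r).
Proof.
move=> y /= xy; exists (r - dist x y); first by rewrite subr_gt0.
move=> z; rewrite /dball /= => yz; rewrite (le_lt_trans (metric_triangle y _ _))//.
by rewrite -ltrBrDl.
Qed.

Hypothesis borel : @measurable d T = <<s [set A | dopen dist A] >>.

Lemma measurable_dball x r : measurable (dball dist x r).
Proof. by rewrite borel; apply: sub_sigma_algebra; exact: dopen_dball. Qed.

Lemma measurable_dist_r a : measurable_fun setT (dist a).
Proof.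
move=> mD; apply: (measurability _ (RGenInftyO.measurableE R)) => //.
move=> /= _ [_ [x ->] <-]; rewrite setTI preimage_itvNyo.
exact: measurable_dball.
Qed.

(** With [u] dense, [dist x y < r] holds exactly when some [u n] satisfies
    [dist (u n) x + dist (u n) y < r]. The sublevel set is thus a countable union of sets measurable
    for the product structure. *)
Lemma measurable_metric : dseparable dist ->
  measurable_fun setT (fun z : T * T => dist z.1 z.2).
Proof.
move=> [u udense] mD; apply: (measurability _ (RGenInftyO.measurableE R)) => //.
move=> /= _ [_ [r ->] <-]; rewrite setTI preimage_itvNyo.
rewrite [X in measurable X](_ : _ =
    \bigcup_n ((fun z : T * T => dist (u n) z.1 + dist (u n) z.2) @^-1` `]-oo, r[)).
  apply: bigcup_measurable => n _; rewrite -[X in measurable X]setTI.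
  apply: measurable_funD => //.
  - by apply: measurableT_comp => //; exact: measurable_dist_r.
  - by apply: measurableT_comp => //; exact: measurable_dist_r.
apply/seteqP; split => [[x y]/= xyr|[x y] [n _] /=].
(* Half the slack, because the detour through [u n] uses [dist x (u n)] twice. *)
- have e0 : 0 < (r - dist x y) / 2 by rewrite divr_gt0// subr_gt0.
  have [n xn] := udense x _ e0; exists n => //=; rewrite in_itv/=.
  rewrite [dist (u n) x]metricC.
  apply: (@le_lt_trans _ _ (dist x (u n) + (dist x (u n) + dist x y))).
    by rewrite lerD2l [dist x (u n)]metricC metric_triangle.
  by rewrite addrA -ltrBrDr [ltRHS]splitr ltrD.
- rewrite in_itv/=; apply: le_lt_trans.
  by rewrite [dist (u n) x]metricC metric_triangle.
Qed.

Hypothesis cpt : dcompact dist.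

(** Balls of integer radius about one point cover the space, and a finite subcover lies in its
    largest ball. *)
Lemma dcompact_bounded : exists D, forall x y, dist x y <= D.
Proof.
pose x0 : T := point.
have [|x _|F /finite_seqP[s Fs] TF] :=
    cpt nat (fun n => dball dist x0 n.+1%:R).
- by move=> n; exact: dopen_dball.
- exists (Num.bound (dist x0 x)) => //; rewrite /dball /=.
  rewrite (@lt_le_trans _ _ (Num.bound (dist x0 x))%:R)//.
    by rewrite archi_boundP// metric_ge0.
  by rewrite ler_nat.
pose N := (\max_(i <- s) i).+1.
have le x : dist x0 x <= N%:R.
  have [n] := TF x I; rewrite Fs /= => ns xn; rewrite (le_trans (ltW xn))//.
  by rewrite ler_nat ltnS; exact: (leq_bigmax_seq _ ns).
exists (N%:R + N%:R) => x y; rewrite (le_trans (metric_triangle x0 _ _))//.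
by rewrite lerD// metricC.
Qed.

(** A finite cover by balls of radius [r / 2] is made disjoint by sending [x] to the index of the
    first center near it. *)
Lemma dcompact_partition (r : R) : 0 < r ->
  exists k (f : T -> nat), [/\ forall x, (f x < k)%N,
    forall i, measurable (f @^-1` [set i]) &
    forall x y, f x = f y -> dist x y < r].
Proof.
move=> r0; have r2 : 0 < r / 2 by rewrite divr_gt0.
have [|x _|F /finite_seqP[s Fs] TF] := cpt T (fun x => dball dist x (r / 2)).
- by move=> n; exact: dopen_dball.
- by exists x => //; rewrite /dball /= metricxx.
pose near_ x c := dist c x < r / 2.
have has_s x : has (near_ x) s.
  by have [c] := TF x I; rewrite Fs /= => cs xc; apply/hasP; exists c.
exists (size s), (fun x => find (near_ x) s); split.
- by move=> x; rewrite -has_find.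
(* Induction on the list of centers: level [0] is the ball of the head, and level [i + 1] is level
   [i] of the tail minus that ball. For the empty list the index is always [0]. *)
- move=> {TF has_s Fs}; elim: s => [|c s IH] [|i].
  + by rewrite [X in measurable X](_ : _ = setT)//; apply/seteqP; split.
  + by rewrite [X in measurable X](_ : _ = set0)//; apply/seteqP; split.
  + rewrite [X in measurable X](_ : _ = dball dist c (r / 2)).
      exact: measurable_dball.
    by apply/seteqP; split => x; rewrite /= /dball /= -/(near_ x c);
      case: ifPn.
  + rewrite [X in measurable X](_ : _ = ~` dball dist c (r / 2) `&`
        [set x | find (near_ x) s = i]).
      by apply: measurableI; [exact: (measurableC (measurable_dball c (r / 2)))|exact: IH].
    apply/seteqP; split => x; rewrite /= /dball /= -/(near_ x c).
      by case: ifPn => // /negP ? [].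
    by case: ifPn => [? []//|_ [_ ->]].
- move=> x y fxy; pose c := nth x s (find (near_ x) s).
  have cx : dist c x < r / 2 by exact: (nth_find x (has_s x)).
  have cy : dist c y < r / 2 by rewrite /c fxy; exact: (nth_find x (has_s y)).
  rewrite (le_lt_trans (metric_triangle c _ _))// [ltRHS]splitr.
  by rewrite ltrD// metricC.
Qed.

End metric_lemmas.

(** * Limits along ultrafilters *)

Lemma ultra_fmap {S S' : Type} (f : S -> S') (F : set_system S) :
  UltraFilter F -> UltraFilter (fmap f F).
Proof.
move=> FU; have FP := @ultra_proper _ _ FU; split; first exact: fmap_proper_filter.
move=> G GG FG; apply/seteqP; split => [A GA|]; last exact: FG.
have [//|nFA] := in_ultra_setVsetC (f @^-1` A) FU.
have /(filterI GA) : G (~` A) by exact: FG.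
by rewrite setICr => /filter_not_empty.
Qed.

(** The image ultrafilter contains the compact segment [[a, b]], hence converges. A single [F]
    serves all bounded sequences at once, in place of successive extractions of subsequences. *)
Lemma ultra_bounded_cvg {R : realType} {S : Type} (F : set_system S) (u : S -> R)
    (a b : R) : UltraFilter F -> (forall n, a <= u n <= b) ->
  exists l : R, u x @[x --> F] --> l.
Proof.
move=> FU uab; have := @segment_compact R a b; rewrite compact_ultra => cab.
have [|l [_ ul]] := cab (fmap u F) (ultra_fmap u F FU); last by exists l.
have FP := @ultra_proper _ _ FU.
by apply: (@filterE _ F) => x /=; rewrite in_itv/=; exact: uab.
Qed.

(** * Couplings with prescribed block masses *)

Lemma measure_level_sum {d} {T : measurableType d} {R : realType}
    (P : {measure set T -> \bar R}) (f : T -> nat) k A :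
  (forall x, (f x < k)%N) -> (forall i, measurable (f @^-1` [set i])) ->
  measurable A -> P A = (\sum_(i < k) P (A `&` f @^-1` [set val i]))%E.
Proof.
move=> fk mf mA.
pose F i := A `&` f @^-1` [set i].
have mF i : measurable (F i) by exact: measurableI.
have tF : trivIset setT F.
  by move=> i j _ _ [x [[_ /= <-] [_ /= <-]]].
have AE : A = \big[setU/set0]_(i < k) F i.
  rewrite -bigcup_mkord; apply/seteqP; split => [x Ax|x [i _] []//].
  by exists (f x) => //=; exact: fk.
rewrite [in LHS]AE measure_semi_additive_ord_I//; last by rewrite -AE.
exact: sub_trivIset tF.
Qed.

(** This computes a marginal of the block coupling on a part of mass [x] of a block of mass [mu].
    Each term equals [m j * (x / mu)], also when [nu j = 0] since then [m j = 0]; when [mu = 0],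
    also [x = 0]. *)
Lemma weighted_row_sum {R : realType} (l : nat) (m nu : nat -> R) (mu x : R) :
  (forall j, (j < l)%N -> nu j = 0 -> m j = 0) ->
  \sum_(j < l) m j = mu -> 0 <= x <= mu ->
  \sum_(j < l) m j / (mu * nu j) * (x * nu j) = x.
Proof.
move=> m0 smu /andP[x0 xmu]; have [mu0|mu0] := eqVneq mu 0.
  have -> : x = 0 by apply/eqP; rewrite eq_le x0 andbT -mu0.
  by rewrite big1// => j _; rewrite mul0r mulr0.
rewrite (eq_bigr (fun j : 'I_l => m j * (x / mu))) => [|j _].
  by rewrite -mulr_suml smu mulrCA mulfV// mulr1.
have [nu0|nu0] := eqVneq (nu j) 0; first by rewrite (m0 j)// !mul0r.
by field; rewrite mu0.
Qed.

Section block_coupling.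
Context {d1 d2} {T1 : measurableType d1} {T2 : measurableType d2} {R : realType}.
Variables (muX : probability T1 R) (muY : probability T2 R).
Variables (f1 : T1 -> nat) (f2 : T2 -> nat) (k l : nat).
Hypotheses (f1k : forall x, (f1 x < k)%N) (f2l : forall y, (f2 y < l)%N).
Hypotheses (mf1 : forall i, measurable (f1 @^-1` [set i]))
  (mf2 : forall j, measurable (f2 @^-1` [set j])).

Definition block i j : set (T1 * T2) := f1 @^-1` [set i] `*` f2 @^-1` [set j].

Lemma measurable_block i j : measurable (block i j).
Proof. exact: measurableX. Qed.

Let muf i := fine (muX (f1 @^-1` [set i])).
Let nuf j := fine (muY (f2 @^-1` [set j])).

Lemma block_coupling (m : nat -> nat -> R) :
  (forall i j, 0 <= m i j) ->
  (forall i, (i < k)%N -> \sum_(j < l) m i j = muf i) ->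
  (forall j, (j < l)%N -> \sum_(i < k) m i j = nuf j) ->
  exists2 sigma, couplings muX muY sigma &
    forall i j, m i j = 0 -> (sigma (block i j) = 0)%E.
Proof.
move=> m0 mrow mcol.
have c0 i j : 0 <= m i j / (muf i * nuf j).
  by rewrite divr_ge0// mulr_ge0// fine_ge0.
have mrow0 i j : (i < k)%N -> (j < l)%N -> muf i = 0 -> m i j = 0.
  move=> ik jl; rewrite -mrow// => /psumr_eq0P; move/(_ (fun j _ => m0 i j)).
  by move/(_ (Ordinal jl) isT).
have mcol0 i j : (i < k)%N -> (j < l)%N -> nuf j = 0 -> m i j = 0.
  move=> ik jl; rewrite -mcol// => /psumr_eq0P; move/(_ (fun i _ => m0 i j)).
  by move/(_ (Ordinal ik) isT).
(* On block [(i, j)] the density with respect to [muX \x muY] is [m i j / (muf i * nuf j)]. Where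
   the denominator vanishes so does [m i j], hence the value [0] given to the quotient loses no
   mass. *)
pose mm : {measure set (T1 * T2) -> \bar R} := msum (fun i => msum (fun j =>
  mscale (NngNum (c0 i j)) (mrestr (muX \x muY)%E (measurable_block i j))) l) k.
have mmE A B : measurable A -> measurable B -> mm (A `*` B) =
    (\sum_(i < k) \sum_(j < l) m i j / (muf i * nuf j) *
       (fine (muX (A `&` f1 @^-1` [set val i])) *
        fine (muY (B `&` f2 @^-1` [set val j]))))%:E.
  move=> mA mB; rewrite -sumEFin; apply: eq_bigr => i _.
  rewrite -sumEFin; apply: eq_bigr => j _.
  have mAi : measurable (A `&` f1 @^-1` [set val i]) by exact: measurableI.
  have mBj : measurable (B `&` f2 @^-1` [set val j]) by exact: measurableI.
  rewrite EFinM [X in (_ * X)%E]EFinM !fineK ?fin_num_measure//; congr (_ * _)%E.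
  transitivity ((muX \x muY)%E ((A `*` B) `&` block i j)); first by [].
  by rewrite -setXI; exact: product_measure1E.
have mm1 A : measurable A -> mm (A `*` setT) = muX A.
  move=> mA; rewrite mmE// (measure_level_sum muX f1 k)//.
  rewrite -sumEFin; apply: eq_bigr => i _.
  under eq_bigr do rewrite setTI.
  have mAi : measurable (A `&` f1 @^-1` [set val i]) by exact: measurableI.
  rewrite (weighted_row_sum _ _ nuf) ?fineK ?fin_num_measure//.
  - by move=> j jl; exact: mcol0.
  - exact: mrow.
  - rewrite fine_ge0//= fine_le ?fin_num_measure//.
    by rewrite le_measure ?inE.
have mm2 B : measurable B -> mm (setT `*` B) = muY B.
  move=> mB; rewrite mmE// (measure_level_sum muY f2 l)//.
  rewrite exchange_big/= -sumEFin; apply: eq_bigr => j _.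
  under eq_bigr do rewrite setTI [_ * fine (muY _)]mulrC [muf _ * nuf _]mulrC.
  have mBj : measurable (B `&` f2 @^-1` [set val j]) by exact: measurableI.
  rewrite (weighted_row_sum _ (m ^~ j) muf) ?fineK ?fin_num_measure//.
  - by move=> i ik; exact: mrow0.
  - exact: mcol.
  - rewrite fine_ge0//= fine_le ?fin_num_measure//.
    by rewrite le_measure ?inE.
have [|sigma sE] := probability_of_measure mm.
  by rewrite -setXTT mm1// probability_setT.
exists sigma; first split => A mA.
- etransitivity; first exact: sE.
  rewrite -mm1//; congr (mm _).
  by apply/seteqP; split => [] [x y]//= [].
- etransitivity; first exact: sE.
  rewrite -mm2//; congr (mm _).
  by apply/seteqP; split => [] [x y]//= [].
(* Other blocks are disjoint from block [(i, j)], and its own term has coefficient zero. *)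
- move=> i j mij; rewrite sE /block mmE// big1// => i' _; rewrite big1// => j' _.
  have [ii'|/eqP ii'] := eqVneq i (val i'); last first.
    rewrite [X in muX X](_ : _ = set0) ?measure0 ?mul0r ?mulr0//.
    by apply/seteqP; split => // x [/= fi fi']; apply: ii'; exact: etrans (esym fi) fi'.
  have [jj'|/eqP jj'] := eqVneq j (val j'); last first.
    rewrite [X in muY X](_ : _ = set0) ?measure0 ?mulr0//.
    by apply/seteqP; split => // y [/= fj fj']; apply: jj'; exact: etrans (esym fj) fj'.
  by rewrite -ii' -jj' mij !mul0r.
Qed.

End block_coupling.

(** * Limits of block masses *)

Lemma eq_of_le_sum {R : numDomainType} (u v : nat -> R) k :
  (forall i, u i <= v i) -> \sum_(i < k) u i = 1 -> \sum_(i < k) v i = 1 ->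
  forall i, (i < k)%N -> u i = v i.
Proof.
move=> uv u1 v1 i ik.
have /psumr_eq0P vu : \sum_(i < k) (v i - u i) = 0 by rewrite sumrB u1 v1 subrr.
apply/esym/eqP; rewrite -subr_eq0; apply/eqP.
by apply: (vu _ (Ordinal ik) isT) => j _; rewrite subr_ge0.
Qed.

(** In the limit the row and column sums are only bounded by [mu] and [nu]; as all the totals are
    one, these bounds are equalities. *)
Lemma limit_weights {R : realType} (U : set_system nat) (dl : nat -> R)
    (m : nat -> nat -> nat -> R) (mu nu : nat -> R) (k l : nat) :
  UltraFilter U -> dl n @[n --> U] --> (0 : R) ->
  (forall n i j, 0 <= m n i j <= 1) ->
  (forall n i, \sum_(j < l) m n i j <= (1 + dl n) * mu i) ->
  (forall n j, \sum_(i < k) m n i j <= (1 + dl n) * nu j) ->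
  (forall n, \sum_(i < k) \sum_(j < l) m n i j = 1) ->
  \sum_(i < k) mu i = 1 -> \sum_(j < l) nu j = 1 ->
  exists M : nat -> nat -> R,
    [/\ forall i j, m n i j @[n --> U] --> M i j,
      forall i j, 0 <= M i j,
      forall i, (i < k)%N -> \sum_(j < l) M i j = mu i &
      forall j, (j < l)%N -> \sum_(i < k) M i j = nu j].
Proof.
move=> UU dl0 m01 mrow mcol msum1 mu1 nu1; have UP := @ultra_proper _ _ UU.
have /choice[M' M'P] ij : exists M : R, m n ij.1 ij.2 @[n --> U] --> M.
  exact: (ultra_bounded_cvg U (fun n => m n ij.1 ij.2) 0 1).
pose M i j := M' (i, j); exists M.
have MP i j : m n i j @[n --> U] --> M i j := M'P (i, j).
have M0 i j : 0 <= M i j.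
  by apply: (cvgr_to_ge (MP i j)); apply: filterE => n; case/andP: (m01 n i j).
have cvg_scaled (x : R) : (1 + dl n) * x @[n --> U] --> x.
  rewrite -[X in _ --> X]mul1r -{2}(addr0 1); apply: cvgMr_tmp.
  by apply: cvgD => //; exact: cvg_cst.
have Mrow_cvg i : \sum_(j < l) m n i j @[n --> U] --> \sum_(j < l) M i j.
  by apply: cvg_big => //; exact: add_continuous.
have Mcol_cvg j : \sum_(i < k) m n i j @[n --> U] --> \sum_(i < k) M i j.
  by apply: cvg_big => //; exact: add_continuous.
have Mrow_le i : \sum_(j < l) M i j <= mu i.
  apply: (ler_cvg_to (Mrow_cvg i) (cvg_scaled (mu i))).
  by apply: filterE => n; exact: mrow.
have Mcol_le j : \sum_(i < k) M i j <= nu j.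
  apply: (ler_cvg_to (Mcol_cvg j) (cvg_scaled (nu j))).
  by apply: filterE => n; exact: mcol.
have Msum1 : \sum_(i < k) \sum_(j < l) M i j = 1.
  have cM : \sum_(i < k) \sum_(j < l) m n i j @[n --> U] -->
      \sum_(i < k) \sum_(j < l) M i j.
    by apply: cvg_big => //; exact: add_continuous.
  have c1 : \sum_(i < k) \sum_(j < l) m n i j @[n --> U] --> (1 : R).
    by under eq_cvg do rewrite msum1; exact: cvg_cst.
  exact: (cvg_unique (@norm_hausdorff _ _) cM c1).
split => //.
- exact: (eq_of_le_sum (fun i => \sum_(j < l) M i j) mu).
- apply: (eq_of_le_sum (fun j => \sum_(i < k) M i j) nu) => //.
  by rewrite exchange_big Msum1.
Qed.

(** * The case of the infinite exponent *)

Section infinite_exponent.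
Local Open Scope ereal_scope.
Context {d1 d2} {T1 : measurableType d1} {T2 : measurableType d2} {R : realType}.
Variables (dX : T1 -> T1 -> R) (dY : T2 -> T2 -> R).
Variables (muX : probability T1 R) (muY : probability T2 R).
Hypotheses (cX : compact_pmm dX muX) (cY : compact_pmm dY muY).

Local Notation gap := (gap dX dY).

Lemma measurable_gap : measurable_fun setT gap.
Proof.
case: cX cY => [mX bX _ sX _] [mY bY _ sY _]; apply: measurable_funB.
- apply: (@measurableT_comp _ _ _ _ _ _ (fun z : T1 * T1 => dX z.1 z.2) _
    (fun z : (T1 * T2) * (T1 * T2) => (z.1.1, z.2.1))).
    exact: measurable_metric.
  by apply: measurable_fun_pair; exact: measurableT_comp.
- apply: (@measurableT_comp _ _ _ _ _ _ (fun z : T2 * T2 => dY z.1 z.2) _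
    (fun z : (T1 * T2) * (T1 * T2) => (z.1.2, z.2.2))).
    exact: measurable_metric.
  by apply: measurable_fun_pair; exact: measurableT_comp.
Qed.

Lemma gap_bounded : exists D, forall z, (`|gap z| <= D)%R.
Proof.
case: cX cY => [mX _ _ _ kX] [mY _ _ _ kY].
have [DX DXP] := dcompact_bounded dX mX kX.
have [DY DYP] := dcompact_bounded dY mY kY.
exists (DX + DY)%R => z; rewrite (le_trans (ler_normB _ _))//.
by rewrite lerD// ger0_norm// metric_ge0.
Qed.

(** The quadrangle inequality is applied to [dX] and to [dY], each time at a cost of [2 * r]. *)
Lemma gap_near (r : R) z w : (dX z.1.1 w.1.1 < r)%R -> (dY z.1.2 w.1.2 < r)%R ->
  (dX z.2.1 w.2.1 < r)%R -> (dY z.2.2 w.2.2 < r)%R ->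
  (`|gap z| <= `|gap w| + 4 * r)%R.
Proof.
case: cX cY => [mX _ _ _ _] [mY _ _ _ _] h1 h2 h3 h4.
have hX := metric_quad dX mX z.1.1 z.2.1 w.1.1 w.2.1.
have hY := metric_quad dY mY z.1.2 z.2.2 w.1.2 w.2.2.
have : (`|gap z - gap w| <= 4 * r)%R.
  rewrite /gap opprB addrACA [(- dY _ _ + _)%R]addrC.
  rewrite (_ : (_ + _ = (dX z.1.1 z.2.1 - dX w.1.1 w.2.1)
    - (dY z.1.2 z.2.2 - dY w.1.2 w.2.2))%R); last by ring.
  by rewrite (le_trans (ler_normB _ _))//; lra.
by have := ler_normD (gap z - gap w)%R (gap w); rewrite subrK; lra.
Qed.

Lemma dist_gap_oo_le pi (c : \bar R) :
  dist_gap dX dY pi +oo <= c <->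
  \forall z \ae (pi \x pi), (`|gap z|)%:E <= c.
Proof.
rewrite /dist_gap unlock.
(* The norm at [+oo] is the essential supremum only on a space of positive mass. *)
rewrite ifT; last first.
  by rewrite [X in _ < X](_ : _ = 1) ?lte01//; exact: probability_setT.
by split => [/ess_supP|h]; last exact/ess_supP.
Qed.

Lemma GW_oo_fin_num : GW dX dY muX muY +oo \is a fin_num.
Proof.
rewrite ge0_fin_numE; last first.
  by apply: le_ereal_inf_tmp=> _ [pi _ <-]; exact: Lnorm_ge0.
have [D gD] := gap_bounded; have [pi cpi] := couplings_nonempty muX muY.
apply: (@le_lt_trans _ _ D%:E); last exact: ltry.
apply: (@le_trans _ _ (dist_gap dX dY pi +oo)).
  by apply: ereal_inf_lbound; exists pi.
by apply/dist_gap_oo_le/nearW => z; rewrite lee_fin.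
Qed.

(** Otherwise [A * B] would lie in the null set where the gap exceeds [c], although its mass
    [pi A * pi B] is positive. *)
Lemma positive_blocks_gap (pi : probability (T1 * T2)%type R)
    (A B : set (T1 * T2)) (c : \bar R) :
  measurable A -> measurable B -> 0 < pi A -> 0 < pi B ->
  dist_gap dX dY pi +oo <= c ->
  exists w, [/\ A w.1, B w.2 & (`|gap w|)%:E <= c].
Proof.
move=> mA mB A0 B0 /dist_gap_oo_le[N [mN N0 hN]].
apply: contrapT => nw; have : (pi \x pi) (A `*` B) = 0.
  apply: subset_measure0 N0 => //; first exact: measurableX.
  by move=> [z z'] [/= Az Bz']; apply: hN => /= h; apply: nw; exists (z, z').
by rewrite product_measure1E// => /eqP; rewrite gt_eqF// mule_gt0.
Qed.

Lemma ae_prod_notin (sigma : probability (T1 * T2)%type R) (A : set (T1 * T2)) :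
  measurable A -> sigma A = 0 -> \forall z \ae (sigma \x sigma), ~ A z.1 /\ ~ A z.2.
Proof.
move=> mA A0.
have mAT : measurable (A `*` [set: T1 * T2]) by exact: measurableX.
have mTA : measurable ([set: T1 * T2] `*` A) by exact: measurableX.
exists (A `*` setT `|` setT `*` A); split.
- exact: measurableU.
- apply/eqP; rewrite -measure_le0.
  rewrite (le_trans (measureU2 _ mAT mTA))//.
  rewrite [X in X + _]product_measure1E// [X in _ + X]product_measure1E//.
  by rewrite [X in X * _ + _]A0 [X in _ + _ * X]A0 mul0e mule0 adde0.
- move=> [z w] /= /not_andP[] /contrapT Az; [left|right]; split => //.
Qed.

Lemma GW_le_Ceps_oo (e : R) : (0 < e)%R ->
  exists2 dl : R, (0 < dl)%R & forall pi, Ceps muX muY (dl, dl) pi ->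
    GW dX dY muX muY +oo <= dist_gap dX dY pi +oo + e%:E.
Proof.
(* By contradiction: if no [dl] works, each [1 / (n + 1)] fails, giving measures [pi n] whose gaps
   stay below [G] by more than [e]. *)
move=> e0; apply: contrapT => nex.
set G := GW dX dY muX muY +oo in nex *; have Gfin : G \is a fin_num := GW_oo_fin_num.
pose dl n : R := (n.+1%:R^-1)%R.
have /choice[pi piP] n : exists pi, Ceps muX muY (dl n, dl n) pi /\
    dist_gap dX dY pi +oo + e%:E < G.
  apply: contrapT => nw; apply: nex; exists (dl n) => [|pi Cpi].
    by rewrite invr_gt0.
  by rewrite leNgt; apply/negP => lt; apply: nw; exists pi.
pose c := (fine G - e)%R.
have gapc n : dist_gap dX dY (pi n) +oo <= c%:E.
  have [_ /ltW] := piP n; rewrite -(fineK Gfin) -leeBrDr//.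
(* By [gap_near], the gap then varies by at most [4 * (e / 8) = e / 2] within blocks, which is less
   than the margin [e]. *)
have e8 : (0 < e / 8)%R by rewrite divr_gt0.
case: (cX) (cY) => [mX bX _ _ kX] [mY bY _ _ kY].
have [k [f1 [f1k mf1 f1e]]] := dcompact_partition dX mX bX kX _ e8.
have [l [f2 [f2l mf2 f2e]]] := dcompact_partition dY mY bY kY _ e8.
have mblock := measurable_block f1 f2 mf1 mf2.
(* [U] refines [\oo], so [dl] still tends to zero along it. *)
have [U [UU sU]] := ultraFilterLemma (F := \oo) _.
have UP := @ultra_proper _ _ UU.
pose m n i j := fine (pi n (block f1 f2 i j)).
have m01 n i j : (0 <= m n i j <= 1)%R.
  rewrite fine_ge0//= -lee_fin fineK ?fin_num_measure//.
  exact: probability_le1.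
have mrow n i : (\sum_(j < l) m n i j)%:E = marg1 (pi n) (f1 @^-1` [set i]).
  rewrite -sumEFin /marg1.
  rewrite (measure_level_sum (pi n) (f2 \o snd) l); last 3 first.
  - by move=> x; exact: f2l.
  - move=> j; rewrite -[X in measurable X]setTI comp_preimage.
    exact: measurable_snd.
  - by rewrite -[X in measurable X]setTI; exact: measurable_fst.
  by apply: eq_bigr => j _; rewrite /m fineK ?fin_num_measure//.
have mcol n j : (\sum_(i < k) m n i j)%:E = marg2 (pi n) (f2 @^-1` [set j]).
  rewrite -sumEFin /marg2.
  rewrite (measure_level_sum (pi n) (f1 \o fst) k); last 3 first.
  - by move=> x; exact: f1k.
  - move=> i; rewrite -[X in measurable X]setTI comp_preimage.
    exact: measurable_fst.
  - by rewrite -[X in measurable X]setTI; exact: measurable_snd.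
  apply: eq_bigr => i _; rewrite /m fineK ?fin_num_measure//.
  by rewrite /block setIC.
pose muf i := fine (muX (f1 @^-1` [set i])).
pose nuf j := fine (muY (f2 @^-1` [set j])).
have cdl : dl n @[n --> U] --> (0 : R)%R.
  by move=> A /(@cvg_harmonic R) ?; exact: sU.
have mrow_le n i : (\sum_(j < l) m n i j <= (1 + dl n) * muf i)%R.
  rewrite -lee_fin mrow EFinM fineK ?fin_num_measure//.
  by have [[piX _] _] := piP n; exact: piX.
have mcol_le n j : (\sum_(i < k) m n i j <= (1 + dl n) * nuf j)%R.
  rewrite -lee_fin mcol EFinM fineK ?fin_num_measure//.
  by have [[_ piY] _] := piP n; exact: piY.
have msum1 n : (\sum_(i < k) \sum_(j < l) m n i j = 1)%R.
  apply: EFin_inj; rewrite -sumEFin -(marg1_setT (pi n)).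
  rewrite (measure_level_sum (marg1 (pi n)) f1 k)//.
  by apply: eq_bigr => i _; rewrite mrow setTI.
have muf1 : (\sum_(i < k) muf i = 1)%R.
  apply: EFin_inj; rewrite -sumEFin -(probability_setT muX).
  rewrite (measure_level_sum muX f1 k)//.
  by apply: eq_bigr => i _; rewrite setTI fineK ?fin_num_measure.
have nuf1 : (\sum_(j < l) nuf j = 1)%R.
  apply: EFin_inj; rewrite -sumEFin -(probability_setT muY).
  rewrite (measure_level_sum muY f2 l)//.
  by apply: eq_bigr => j _; rewrite setTI fineK ?fin_num_measure.
have [M [MP M0 Mrow Mcol]] := limit_weights U dl m muf nuf k l UU cdl m01
  mrow_le mcol_le msum1 muf1 nuf1.
have [sigma csigma sigma0] :=
  block_coupling muX muY f1 f2 k l f1k f2l mf1 mf2 M M0 Mrow Mcol.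
have : dist_gap dX dY sigma +oo <= (c + 4 * (e / 8))%:E.
  apply/dist_gap_oo_le.
  (* Countably many null sets are discarded together, so almost surely both points of [z] lie in
     blocks of positive limit mass. *)
  have : \forall z \ae (sigma \x sigma), forall i j, M i j = 0%R ->
      ~ block f1 f2 i j z.1 /\ ~ block f1 f2 i j z.2.
    apply/ae_foralln => i; apply/ae_foralln => j.
    have [Mij|Mij] := eqVneq (M i j) 0%R; last first.
      by apply: nearW => z /eqP; rewrite (negbTE Mij).
    apply: filterS (ae_prod_notin sigma _ (mblock i j) (sigma0 i j Mij)) => z zij _.
    exact: zij.
  apply: filterS => z zM.
  pose A := block f1 f2 (f1 z.1.1) (f2 z.1.2).
  pose B := block f1 f2 (f1 z.2.1) (f2 z.2.2).
  have UA : U [set n | 0 < m n (f1 z.1.1) (f2 z.1.2)]%R.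
    have : (0 < M (f1 z.1.1) (f2 z.1.2))%R.
      rewrite lt_neqAle M0 andbT eq_sym; apply/eqP => /zM[].
      by rewrite /block /=; case.
    by apply: cvgr_gt; exact: MP.
  have UB : U [set n | 0 < m n (f1 z.2.1) (f2 z.2.2)]%R.
    have : (0 < M (f1 z.2.1) (f2 z.2.2))%R.
      rewrite lt_neqAle M0 andbT eq_sym; apply/eqP => /zM[_].
      by rewrite /block /=; case.
    by apply: cvgr_gt; exact: MP.
  (* The same [n] must charge both blocks, so that [pi n \x pi n] charges their product. *)
  have [n [/= nA nB]] := filter_ex (filterI UA UB).
  have posA : 0 < pi n A.
    by rewrite -[pi n A]fineK ?lte_fin// fin_num_measure//; exact: mblock.
  have posB : 0 < pi n B.
    by rewrite -[pi n B]fineK ?lte_fin// fin_num_measure//; exact: mblock.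
  have [w [[/= A1 A2] [/= B1 B2]]] := positive_blocks_gap (pi n) A B c%:E
    (mblock _ _) (mblock _ _) posA posB (gapc n).
  rewrite !lee_fin => wc.
  apply: le_trans (gap_near (e / 8) z w _ _ _ _) _; rewrite ?lerD2r//.
  - exact: f1e.
  - exact: f2e.
  - exact: f1e.
  - exact: f2e.
(* The coupling [sigma] would have gap at most [G - e / 2], below the infimum [G]. *)
apply/negP; rewrite -ltNge.
apply: (@lt_le_trans _ _ G); last by apply: ereal_inf_lbound; exists sigma.
by rewrite -(fineK Gfin) lte_fin /c; lra.
Qed.

End infinite_exponent.

(** * Convergence of the relaxed distances *)

Lemma cvg_squeeze_defect {R : realType} (u : nat -> \bar R) (G : \bar R) :
  (0 <= G)%E -> (forall n, (u n <= G)%E) ->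
  (forall e : R, 0 < e -> \forall n \near \oo, (G <= u n + e%:E)%E) ->
  u @ \oo --> G.
Proof.
case: G => [g||//] G0 uG Gu.
- apply/fine_cvgP; split.
    apply: filterS (Gu 1 ltr01) => n; move: (uG n).
    by case: (u n).
  apply/cvgrPdist_le => e e0; apply: filterS (Gu e e0) => n; move: (uG n).
  rewrite /=; case: (u n) => [r| |] //=; rewrite -EFinD !lee_fin => rg gr.
  by rewrite ger0_norm ?subr_ge0// lerBlDr addrC.
(* For [G = +oo], the bound [+oo <= u n + 1] already forces [u n = +oo]. *)
- apply: cvg_near_cst; apply: filterS (Gu 1 ltr01) => n.
  by case: (u n).
Qed.

Section convergence.
Local Open Scope ereal_scope.
Context {d1 d2} {T1 : measurableType d1} {T2 : measurableType d2} {R : realType}.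
Variables (dX : T1 -> T1 -> R) (dY : T2 -> T2 -> R).
Variables (muX : probability T1 R) (muY : probability T2 R).
Hypotheses (cX : compact_pmm dX muX) (cY : compact_pmm dY muY).

Lemma GW_le_Ceps (p : \bar R) (e : R) : 1 <= p -> (0 < e)%R ->
  exists2 dl : R, (0 < dl)%R & forall pi, Ceps muX muY (dl, dl) pi ->
    GW dX dY muX muY p <= dist_gap dX dY pi p + e%:E.
Proof.
case: p => [p||//] p1 e0; last exact: GW_le_Ceps_oo.
have [D gD] := gap_bounded dX dY muX muY cX cY.
apply: (GW_le_Ceps_fin dX dY muX muY D) => //.
exact: measurable_gap cX cY.
Qed.

Lemma GW_near_PGW (p : \bar R) (eps : nat -> R * R) (e : R) : 1 <= p ->
  (fun n => (eps n).1) @ \oo --> (0 : R)%R -> (fun n => (eps n).2) @ \oo --> (0 : R)%R ->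
  (0 < e)%R ->
  \forall n \near \oo,
    GW dX dY muX muY p <= PGW dX dY muX muY (eps n) p + e%:E.
Proof.
move=> p1 eps1 eps2 e0; have [dl dl0 GWle] := GW_le_Ceps p e p1 e0.
(* Since [dl] depends on [e] alone and not on [pi], the bound applies to every competitor as soon as
   both components of [eps n] are at most [dl]. *)
near=> n; rewrite -leeBlDr//; apply: le_ereal_inf_tmp => _ [pi Cpi <-].
rewrite leeBlDr//; apply: GWle; apply: subset_Ceps Cpi => /=.
- by near: n; exact: (cvgr_le _ eps1).
- by near: n; exact: (cvgr_le _ eps2).
Unshelve. all: by end_near. Qed.

End convergence.

Theorem theorem2p14 (R : realType) (p : \bar R) (eps : nat -> R * R)
    (d1 d2 : measure_display) (T1 : measurableType d1) (T2 : measurableType d2)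
    (dX : T1 -> T1 -> R) (muX : probability T1 R)
    (dY : T2 -> T2 -> R) (muY : probability T2 R) :
  (1%:E <= p)%E ->
  (forall n, 0 <= (eps n).1 /\ 0 <= (eps n).2) ->
  (fun n => (eps n).1) @ \oo --> 0 ->
  (fun n => (eps n).2) @ \oo --> 0 ->
  compact_pmm dX muX -> compact_pmm dY muY ->
  (fun n => PGW dX dY muX muY (eps n) p) @ \oo --> GW dX dY muX muY p /\
  (fun n => sPGW dX dY muX muY (eps n) p) @ \oo --> GW dX dY muX muY p.
Proof.
move=> p1 eps0 eps1 eps2 cX cY.
have G0 : (0 <= GW dX dY muX muY p)%E.
  by apply: le_ereal_inf_tmp => _ [pi _ <-]; exact: Lnorm_ge0.
have PsP n : (PGW dX dY muX muY (eps n) p <= sPGW dX dY muX muY (eps n) p)%E.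
  have [e1 e2] := eps0 n.
  by apply: ereal_inf_le_tmp; apply: image_subset; exact: Seps_Ceps.
have sPG n : (sPGW dX dY muX muY (eps n) p <= GW dX dY muX muY p)%E.
  have [e1 e2] := eps0 n.
  by apply: ereal_inf_le_tmp; apply: image_subset; exact: couplings_Seps.
have GP e : 0 < e -> \forall n \near \oo,
    (GW dX dY muX muY p <= PGW dX dY muX muY (eps n) p + e%:E)%E.
  exact: GW_near_PGW.
split; apply: cvg_squeeze_defect => //.
- by move=> n; exact: le_trans (PsP n) (sPG n).
(* The lower bound for [sPGW] is inherited from [PGW <= sPGW]. *)
- move=> e e0; apply: filterS (GP e e0) => n /le_trans; apply.
  exact: leeD2r.
Qed.
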